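(* Let $(Q,\ast_i)$ be a finite indexed quandle, $A$ an abelian group (written multiplicatively) and $\phi:Q\times Q\to A$ an indexed quandle 2-cocycle. For a virtual knot diagram $K$ define $$\Phi_\phi(K)=\sum_{f}\prod_{x}\phi(a_x^f,b_x^f)^{w(x)}\in\mathbb{Z}[A],$$ where $f$ runs over all homomorphisms $IndQ_K\to(Q,\ast_i)$ (equivalently, colorings of the arcs), $x$ runs over all real crossings, and at $x$ the over-arc is colored $b_x^f$ and the under-arc to the right of the over-arc is colored $a_x^f$. Then $\Phi_\phi(K)$ is a virtual knot invariant.
   Context: An indexed quandle is a set $Q$ with binary operations $\ast_i$ ($i\in\mathbb{Z}$) such that: (1) $a\ast_0 a=a$; (2) for all $b,c$ and $i$ there is a unique $a$ with $a\ast_i b=c$; (3) $(a\ast_i b)\ast_j c=(a\ast_j c)\ast_i(b\ast_{j-i}c)$ for all $a,b,c$, $i,j$. An indexed quandle 2-cocycle is a map $\phi:Q\times Q\to A$ with $\phi(a,a)=1$ for all $a$ and $\phi(a,c)^{-1}\phi(a\ast_{i-j}b,c)\,\phi(a,b)\,\phi(a\ast_i c,b\ast_j c)^{-1}=1$ for all $a,b,c\in Q$ and $i,j\in\mathbb{Z}$. Chord index: in the Gauss diagram (counterclockwise circle, one chord per real crossing directed from over- to under-preimage and signed by the writhe $w$), $\mathrm{Ind}(c)=r_+(c)-r_-(c)-l_+(c)+l_-(c)$, where $r_\pm(c)$ (resp. $l_\pm(c)$) counts chords of sign $\pm$ interlacing $c$ with tail left (resp. right) and head right (resp. left) of the arrow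 $c$. $IndQ_K$: generated by the arcs of $K$ (pieces from undercrossing to undercrossing) with, at each real crossing of index $i$ with over-arc $b$, under-arc $a$ to the right of the over-arc (with respect to its orientation) and other under-arc $a'$, the relation $a'=a\ast_i b$. *)

(* Defs.v *)
From HB Require Import structures.
From mathcomp Require Import all_boot all_order all_algebra.
From Stdlib Require Import Relations.
Set Implicit Arguments. Unset Strict Implicit. Unset Printing Implicit Defensive.
Import GRing.Theory.

Record indexed_quandle (Q : Type) (op : int -> Q -> Q -> Q) : Prop := {
  iq_idem : forall a : Q, op 0%R a a = a;
  iq_rdiv : forall (i : int) (b c : Q), exists! a : Q, op i a b = c;
  iq_dist : forall (i j : int) (a b c : Q),
      op j (op i a b) c = op i (op j a c) (op (j - i)%R b c) }.

(* Indexed quandle 2-cocycle with values in an abelian group A, written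
   additively (A : zmodType): the multiplicative identity
   phi(a,c)^-1 phi(a *_{i-j} b, c) phi(a,b) phi(a *_i c, b *_j c)^-1 = 1
   becomes the additive identity below. *)
Definition iq_2cocycle (Q : Type) (A : zmodType) (op : int -> Q -> Q -> Q)
    (phi : Q -> Q -> A) : Prop :=
  (forall a : Q, phi a a = 0%R) /\
  (forall (a b c : Q) (i j : int),
      (- phi a c + phi (op (i - j)%R a b) c + phi a b
         - phi (op i a c) (op j b c) = 0)%R).

(* The circle (oriented counterclockwise = along the knot) is read as a *)
(* cyclic word; each endpoint of a chord is a letter                    *)
(*   (label, is_tail, is_positive)                                      *)
(* where is_tail = true for the over-preimage (tail of the arrow) and   *)
(* false for the under-preimage (head), and is_positive is the writhe   *)
(* of the crossing (true = +1, false = -1).                             *)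
Definition letter := (nat * bool * bool)%type.
Definition lab (x : letter) : nat := x.1.1.
Definition ovr (x : letter) : bool := x.1.2.
Definition sgn (x : letter) : bool := x.2.
Definition gword := seq letter.
Definition x0 : letter := (0%N, false, false).

Definition labels (w : gword) : seq nat := map lab w.

Definition wf_gword (w : gword) : Prop :=
  forall x, x \in w ->
    [/\ count (fun y => lab y == lab x) w = 2%N,
        count (fun y => [&& lab y == lab x, ovr y & sgn y == sgn x]) w = 1%N &
        count (fun y => [&& lab y == lab x, ~~ ovr y & sgn y == sgn x]) w = 1%N].

Definition tailpos (w : gword) (l : nat) : nat :=
  find (fun y => (lab y == l) && ovr y) w.
Definition headpos (w : gword) (l : nat) : nat :=
  find (fun y => (lab y == l) && ~~ ovr y) w.

(* p lies strictly inside the arc going counterclockwise from position t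
   to position h, i.e. on the right-hand side of the arrow t -> h. *)
Definition in_right_arc (t h p : nat) : bool :=
  if (t < h)%N then (t < p < h)%N else (t < p)%N || (p < h)%N.

(* Ind(c) = r_+(c) - r_-(c) - l_+(c) + l_-(c); the sum runs over the
   heads of the other chords. *)
Definition chord_index (w : gword) (l : nat) : int :=
  let t := tailpos w l in
  let h := headpos w l in
  (\sum_(p < size w)
     let y := nth x0 w p in
     if ovr y || (lab y == l) then 0
     else
       let s : int := if sgn y then 1 else -1 in
       let hr := in_right_arc t h p in
       let tr := in_right_arc t h (tailpos w (lab y)) in
       if hr && ~~ tr then s          (* tail left, head right: r_sign *)
       else if tr && ~~ hr then - s   (* tail right, head left: l_sign *)
       else 0)%R.

(* Colorings.  The endpoints cut the circle into gaps; gap p (p < size w)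
   is the gap just after position p (for the empty word there is one gap,
   the whole circle).  A coloring of the arcs of K is the same as a
   coloring of the gaps that is constant across tails (over-passages).  *)
Definition ngaps (w : gword) : nat := (size w).-1.+1.
Definition prevpos (w : gword) (p : nat) : nat :=
  if p == 0%N then (size w).-1 else p.-1.
Definition gapc (Q : Type) (w : gword) (col : 'I_(ngaps w) -> Q) (p : nat) : Q :=
  col (inord p).
Arguments gapc {Q} w col p.

(* the condition at position p.  At a head (real crossing) of label l,
   of index i, over-arc colored b: the under-arc on the right of the
   over-arc is the incoming one for a positive crossing and the outgoing
   one for a negative crossing; the other under-arc a' satisfies
   a' = a *_i b. *)
Definition crossing_ok (Q : eqType) (op : int -> Q -> Q -> Q) (w : gword)
    (col : 'I_(ngaps w) -> Q) (p : nat) : bool :=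
  let y := nth x0 w p in
  let cin := gapc w col (prevpos w p) in
  let cout := gapc w col p in
  if ovr y then cout == cin
  else
    let b := gapc w col (tailpos w (lab y)) in
    let i := chord_index w (lab y) in
    if sgn y then cout == op i cin b else cin == op i cout b.
Arguments crossing_ok {Q} op w col p.

Definition is_coloring (Q : eqType) (op : int -> Q -> Q -> Q) (w : gword)
    (col : 'I_(ngaps w) -> Q) : bool :=
  [forall p : 'I_(ngaps w), (p < size w)%N ==> crossing_ok op w col p].
Arguments is_coloring {Q} op w col.

Definition weight (Q : Type) (A : zmodType) (op : int -> Q -> Q -> Q)
    (phi : Q -> Q -> A) (w : gword) (col : 'I_(ngaps w) -> Q) : A :=
  (\sum_(p < size w)
     let y := nth x0 w p in
     if ovr y then 0
     else
       let b := gapc w col (tailpos w (lab y)) in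
       if sgn y then phi (gapc w col (prevpos w p)) b
       else - phi (gapc w col p) b)%R.
Arguments weight {Q A} op phi w col.

(* Phi_phi(K) in Z[A], represented by its coefficient function A -> nat:
   the coefficient of g is the number of colorings of weight g. *)
Definition Phi (Q : finType) (A : zmodType) (op : int -> Q -> Q -> Q)
    (phi : Q -> Q -> A) (w : gword) (g : A) : nat :=
  #|[pred col : {ffun 'I_(ngaps w) -> Q} |
      is_coloring op w col && (weight op phi w col == g)]|.

(* Reidemeister moves on Gauss diagrams (virtual moves are invisible).  *)
Definition r3seg (o : bool) (u v : letter) : gword :=
  if o then [:: u; v] else [:: v; u].

(* Three strands: top T (tails of x and y), middle M (head of x, tail of
   z), bottom B (heads of y and z).  oT : x before y on T, oM : x before
   z on M, oB : y before z on B.  [alt] selects the cyclic order in which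
   the three strands are met. *)
Definition r3word (w1 w2 w3 w4 : gword) (x y z : nat) (sx sy sz : bool)
    (oT oM oB alt : bool) : gword :=
  let T := r3seg oT (x, true, sx) (y, true, sy) in
  let M := r3seg oM (x, false, sx) (z, true, sz) in
  let B := r3seg oB (y, false, sy) (z, false, sz) in
  if alt then w1 ++ T ++ w2 ++ B ++ w3 ++ M ++ w4
  else w1 ++ T ++ w2 ++ M ++ w3 ++ B ++ w4.

Inductive gd_step : gword -> gword -> Prop :=
| gd_rot (w1 w2 : gword) : gd_step (w1 ++ w2) (w2 ++ w1)
| gd_relabel (f : nat -> nat) (w : gword) : injective f ->
    gd_step w (map (fun y => (f (lab y), ovr y, sgn y)) w)
| gd_R1 (w1 w2 : gword) (c : nat) (o s : bool) :
    c \notin labels (w1 ++ w2) ->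
    gd_step (w1 ++ w2) (w1 ++ [:: (c, o, s); (c, ~~ o, s)] ++ w2)
| gd_R2 (w1 w2 w3 : gword) (c d : nat) (s rev : bool) :
    c != d -> c \notin labels (w1 ++ w2 ++ w3) -> d \notin labels (w1 ++ w2 ++ w3) ->
    gd_step (w1 ++ w2 ++ w3)
      (w1 ++ [:: (c, true, s); (d, true, ~~ s)] ++ w2 ++
         (if rev then [:: (d, false, ~~ s); (c, false, s)]
          else [:: (c, false, s); (d, false, ~~ s)]) ++ w3)
| gd_R3 (w1 w2 w3 w4 : gword) (x y z : nat) (sx sy sz oT alt : bool) :
    uniq [:: x; y; z] ->
    gd_step (r3word w1 w2 w3 w4 x y z sx sy sz
               oT (oT (+) sy (+) sz) (oT (+) sx (+) sz) alt)
            (r3word w1 w2 w3 w4 x y z sx sy sz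
               (~~ oT) (~~ (oT (+) sy (+) sz)) (~~ (oT (+) sx (+) sz)) alt).

Definition gd_move (u v : gword) : Prop := [/\ wf_gword u, wf_gword v & gd_step u v].

(* equivalence of virtual knots = equivalence of Gauss diagrams *)
Definition gd_equiv : gword -> gword -> Prop := clos_refl_sym_trans gword gd_move.

(* Main.v *)
(* Summing -1 (resp. +1) over positive tails (resp. heads), with opposite signs
   for negative chords, gives a height along the Gauss word, and the index of a
   chord is the height before its head minus the height after its tail; this
   makes all index computations under the moves local.  Likewise a coloring is
   determined by the colour at the base point together with the over-arc colour
   B(l) of every chord l: these data determine all other colours by reading the
   word, subject to the conditions that the colour met at each tail is B and
   that the reading closes up.  Colorings before and after a move are matched
   through these data: nothing changes outside the modified letters, and the new
   values of B are forced.  For the third move only the over-arc colour of the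
   chord between the middle and bottom strands changes; the heights give
   Ind(top/bottom) = Ind(top/middle) + Ind(middle/bottom), under which
   self-distributivity and the cocycle identity match the bottom strand. *)
Require Import Defs.
From HB Require Import structures.
From mathcomp Require Import all_boot all_order all_algebra.
From mathcomp Require Import zify ring.
Set Implicit Arguments. Unset Strict Implicit. Unset Printing Implicit Defensive.
Import GRing.Theory.

(** * Heights along a Gauss word and chord indices *)

Section ChordIndex.
Local Open Scope ring_scope.

Definition sign (s : bool) : int := if s then 1 else -1.
Definition step (y : letter) : int := if ovr y then - sign (sgn y) else sign (sgn y).
Definition height (w : gword) : int := \sum_(y <- w) step y.

(** Heights before heads minus heights after tails, with [k] as initial height. Keeping [k] as a
    parameter and asking nothing of [w] makes the index additive over concatenation, so a move is
    computed on the few letters it touches. *)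
Fixpoint hindex (k : int) (w : gword) (l : nat) : int :=
  if w is y :: w' then
    (if lab y == l then (if ovr y then - (k + step y) else k) else 0)
      + hindex (k + step y) w' l
  else 0.

Lemma height_cat w1 w2 : height (w1 ++ w2) = height w1 + height w2.
Proof. exact: big_cat. Qed.

Lemma height_cons y w : height (y :: w) = step y + height w.
Proof. exact: big_cons. Qed.

Lemma height_nil : height [::] = 0.
Proof. exact: big_nil. Qed.

Lemma hindex_cat k w1 w2 l :
  hindex k (w1 ++ w2) l = hindex k w1 l + hindex (k + height w1) w2 l.
Proof.
elim: w1 k => [|y w1 IH] k /=; first by rewrite height_nil add0r addr0.
by rewrite IH height_cons !addrA.
Qed.

Lemma hindex_notin k w l : l \notin labels w -> hindex k w l = 0.
Proof.
elim: w k => [|y w IH] k //=.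
by rewrite inE negb_or eq_sym => /andP[/negPf-> /IH->].
Qed.

Lemma hindexE k w l :
  hindex k w l = \sum_(p < size w)
    (if lab (nth x0 w p) == l then
       if ovr (nth x0 w p) then - (k + height (take p.+1 w))
       else k + height (take p w)
     else 0).
Proof.
elim: w k => [|y w IH] k /=; first by rewrite big_ord0.
rewrite big_ord_recl /= take0 height_nil addr0 height_cons height_nil addr0 IH.
congr (_ + _); apply: eq_bigr => p _.
by rewrite /= !height_cons !addrA.
Qed.

Lemma height_take k w : (k <= size w)%N ->
  height (take k w) = \sum_(p < size w | (p < k)%N) step (nth x0 w p).
Proof.
move=> lek; rewrite (big_ord_narrow lek) /height (big_nth x0) size_takel //.
by rewrite big_mkord; apply: eq_bigr => p _; rewrite nth_take.
Qed.

Lemma find_count1 (T : Type) (d : T) (a : pred T) s p :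
  count a s = 1%N -> (p < size s)%N -> a (nth d s p) -> find a s = p.
Proof.
elim: s p => [|x s IH] [|p] //=; first by move=> _ _ ->.
case: (boolP (a x)) => ax /=; last by move=> cs ps /(IH _ cs ps)->.
rewrite add1n => -[cs] ps ap; suff: has a s by rewrite has_count cs.
by apply/(has_nthP d); exists p.
Qed.

Section Wf.
Variable w : gword.
Hypothesis wfw : wf_gword w.

(** The tail and the head sharing the sign of one letter already exhaust the two occurrences of the
    label, so no letter of the opposite sign remains. *)
Lemma wf_count l : l \in labels w -> exists s,
  [/\ count (fun y => (lab y == l) && ovr y) w = 1%N,
      count (fun y => (lab y == l) && ~~ ovr y) w = 1%N &
      {in w, forall y, lab y = l -> sgn y = s}].
Proof.
case/mapP=> x xw ->; exists (sgn x).
have [c2 ct ch] := wfw xw.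
have cU (a : pred letter) b : count a w =
    (count (fun y => a y && b y) w + count (fun y => a y && ~~ b y) w)%N.
  by elim: (w) => //= y v ->; case: (a y); case: (b y) => /=; lia.
have ct' : count (fun y => [&& lab y == lab x, ovr y & sgn y == sgn x]) w
    = count (fun y => ((lab y == lab x) && ovr y) && (sgn y == sgn x)) w.
  by apply: eq_count => y /=; rewrite andbA.
have ch' : count (fun y => [&& lab y == lab x, ~~ ovr y & sgn y == sgn x]) w
    = count (fun y => ((lab y == lab x) && ~~ ovr y) && (sgn y == sgn x)) w.
  by apply: eq_count => y /=; rewrite andbA.
have e1 := cU (fun y => lab y == lab x) ovr.
have e2 := cU (fun y => (lab y == lab x) && ovr y) (fun y => sgn y == sgn x).
have e3 := cU (fun y => (lab y == lab x) && ~~ ovr y) (fun y => sgn y == sgn x).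
rewrite /= in e1 e2 e3.
rewrite ct' in ct; rewrite ch' in ch.
split; [lia | lia |] => y yw ly.
apply/eqP/negPn/negP => ns.
have : (0 < count (fun y => (lab y == lab x) && ovr y && (sgn y != sgn x)) w
        + count (fun y => (lab y == lab x) && ~~ ovr y && (sgn y != sgn x)) w)%N.
  rewrite addn_gt0 -!has_count; case oy: (ovr y).
    by apply/orP; left; apply/hasP; exists y; rewrite //= ly eqxx oy.
  by apply/orP; right; apply/hasP; exists y; rewrite //= ly eqxx oy.
lia.
Qed.

Lemma lab_nth p : (p < size w)%N -> lab (nth x0 w p) \in labels w.
Proof. by move=> pw; apply: map_f; apply: mem_nth. Qed.

Lemma tailposK p : (p < size w)%N -> ovr (nth x0 w p) ->
  tailpos w (lab (nth x0 w p)) = p.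
Proof.
move=> pw op; have [s [ct _ _]] := wf_count (lab_nth pw).
by apply: (find_count1 (d := x0) ct); rewrite //= eqxx.
Qed.

Lemma headposK p : (p < size w)%N -> ~~ ovr (nth x0 w p) ->
  headpos w (lab (nth x0 w p)) = p.
Proof.
move=> pw op; have [s [_ ct _]] := wf_count (lab_nth pw).
by apply: (find_count1 (d := x0) ct); rewrite //= eqxx.
Qed.

Lemma tailposP l : l \in labels w ->
  [/\ (tailpos w l < size w)%N, lab (nth x0 w (tailpos w l)) = l &
      ovr (nth x0 w (tailpos w l))].
Proof.
move=> /wf_count[s [ct _ _]].
have hs : has (fun y => (lab y == l) && ovr y) w by rewrite has_count ct.
by have /andP[/eqP ? ?] := nth_find x0 hs; split; rewrite // -has_find.
Qed.

Lemma headposP l : l \in labels w ->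
  [/\ (headpos w l < size w)%N, lab (nth x0 w (headpos w l)) = l &
      ~~ ovr (nth x0 w (headpos w l))].
Proof.
move=> /wf_count[s [_ ct _]].
have hs : has (fun y => (lab y == l) && ~~ ovr y) w by rewrite has_count ct.
by have /andP[/eqP ? ?] := nth_find x0 hs; split; rewrite // -has_find.
Qed.

Definition partner (p : nat) : nat :=
  let y := nth x0 w p in if ovr y then headpos w (lab y) else tailpos w (lab y).

Lemma partnerP p : (p < size w)%N ->
  [/\ (partner p < size w)%N, lab (nth x0 w (partner p)) = lab (nth x0 w p),
      ovr (nth x0 w (partner p)) = ~~ ovr (nth x0 w p) &
      sgn (nth x0 w (partner p)) = sgn (nth x0 w p)].
Proof.
move=> pw; have lw := lab_nth pw; have [s [_ _ es]] := wf_count lw.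
have [t1 t2 t3] := tailposP lw; have [h1 h2 h3] := headposP lw.
rewrite /partner; case: (ovr (nth x0 w p)); split; rewrite ?(negPf h3) //.
  by rewrite (es _ (mem_nth _ h1) h2) (es _ (mem_nth _ pw)).
by rewrite (es _ (mem_nth _ t1) t2) (es _ (mem_nth _ pw)).
Qed.

Lemma partnerK p : (p < size w)%N -> partner (partner p) = p.
Proof.
move=> pw; have [a b c d] := partnerP pw.
rewrite {1}/partner b c; case op: (ovr (nth x0 w p)) => /=.
  exact: tailposK.
by apply: headposK; rewrite // op.
Qed.

Lemma sum_partner (F : nat -> int) :
  \sum_(p < size w) F p = \sum_(p < size w) F (partner p).
Proof.
have pw (p : 'I_(size w)) : (partner p < size w)%N.
  by have [] := partnerP (ltn_ord p).
have K : involutive (fun p : 'I_(size w) => Ordinal (pw p)).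
  by move=> p; apply: val_inj; apply: partnerK.
by rewrite (reindex_inj (inv_inj K)).
Qed.

Lemma step_partner p : (p < size w)%N ->
  step (nth x0 w (partner p)) = - step (nth x0 w p).
Proof.
move=> pw; have [_ _ o s] := partnerP pw; rewrite /step o s.
by case: (ovr _); rewrite //= opprK.
Qed.

(** Exchanging the two ends of every chord negates each step, so the total equals its own opposite
    and vanishes in [int]. *)
Lemma height_wf : height w = 0.
Proof.
rewrite /height (big_nth x0) big_mkord.
have := sum_partner (fun p => step (nth x0 w p)).
rewrite [in RHS](eq_bigr _ (fun p _ => step_partner (ltn_ord p))) sumrN.
by move: (\sum_(_ < _) _) => S; lia.
Qed.

(** Raising the initial height adds [k] at a head and [- k] at a tail; these cancel under the same
    exchange of ends. *)
Lemma hindex_wf_shift k l : hindex k w l = hindex 0 w l.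
Proof.
rewrite !hindexE; apply/eqP; rewrite -subr_eq0 -sumrB.
pose F p : int := if lab (nth x0 w p) == l then if ovr (nth x0 w p) then - k else k else 0.
rewrite (eq_bigr (fun p : 'I_(size w) => F p)) => [|p _]; last first.
  by rewrite /F; case: ifP => _; [case: ifP => _|]; rewrite ?subrr //; ring.
have := sum_partner F; rewrite [in RHS](eq_bigr (fun p : 'I_(size w) => - F p)).
  by rewrite sumrN; move: (\sum_(_ < _) _) => S e; apply/eqP; lia.
move=> p _; have [_ p2 p3 _] := partnerP (ltn_ord p); rewrite /F p2 p3.
by case: ifP => _; [case: (ovr _)|]; rewrite /= ?opprK ?oppr0.
Qed.

(* Each chord meets the arc through its tail or its head; pairing the two
   endpoints turns the crossing count into a sum of letter steps over the
   right arc, i.e. into a difference of heights. *)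
Lemma chord_indexE l : l \in labels w -> chord_index w l = hindex 0 w l.
Proof.
move=> lw; have [t1 t2 t3] := tailposP lw; have [h1 h2 h3] := headposP lw.
have nth_l p : (p < size w)%N -> lab (nth x0 w p) = l ->
    p = tailpos w l \/ p = headpos w l.
  move=> pw lp; case op: (ovr (nth x0 w p)).
    by left; rewrite -lp tailposK.
  by right; rewrite -lp headposK // op.
set t := tailpos w l in t1 t2 t3 nth_l *; set h := headpos w l in h1 h2 h3 nth_l *.
have th : t != h by apply/eqP => e; move: h3; rewrite -e t3.
have -> : hindex 0 w l = height (take h w) - height (take t.+1 w).
  rewrite hindexE (bigD1 (Ordinal t1)) //= (bigD1 (Ordinal h1)) /=; last first.
    by rewrite -val_eqE /= eq_sym.
  rewrite t2 h2 t3 (negPf h3) eqxx !add0r big1 ?addr0 1?addrC // => p /andP[pt ph].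
  case: eqP => // /(nth_l _ (ltn_ord p)); rewrite -!val_eqE /= in pt ph.
  by case=> e; rewrite e eqxx in pt ph.
pose arc p : int := if in_right_arc t h p then step (nth x0 w p) else 0.
have -> : chord_index w l = \sum_(p < size w) arc p.
  (* [F] collects the heads and [G] the tails of the other chords; reindexing [G] by [partner]
     brings both ends of a chord to its head, where the cases of [chord_index] appear. *)
  pose F p : int := if ovr (nth x0 w p) then 0 else
    if lab (nth x0 w p) == l then 0 else arc p.
  pose G p : int := if ovr (nth x0 w p) then
    if lab (nth x0 w p) == l then 0 else arc p else 0.
  transitivity (\sum_(p < size w) (F p + G p)).
    rewrite big_split /= (sum_partner G) -big_split /=; apply: eq_bigr => p _.
    have [p1 p2 p3 p4] := partnerP (ltn_ord p).
    rewrite /F /G /arc p2 p3 step_partner // /partner -/t -/h.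
    case op: (ovr (nth x0 w p)); rewrite /= ?addr0 ?add0r // /step op.
    rewrite -[if sgn _ then _ else _]/(sign _).
    case: eqP => _; case: (in_right_arc t h p);
    by case: (in_right_arc t h _); rewrite /= ?subrr ?addr0 ?add0r.
  apply: eq_bigr => p _; rewrite /F /G.
  have arc0 : lab (nth x0 w p) = l -> arc p = 0.
    move=> /(nth_l _ (ltn_ord p)); rewrite /arc /in_right_arc.
    by case: (ltnP t h) => th' [] ->; rewrite ?ltnn ?andbF // ltnNge ?th' // ltnW.
  by case: (ovr _); case: eqP => [/arc0->|_]; rewrite ?addr0 ?add0r.
rewrite (height_take (ltnW h1)) (height_take t1).
have := height_wf; rewrite -{1}(take_size w) (height_take (leqnn _)).
rewrite !(big_mkcond (fun p : 'I_(size w) => (_ < _)%N)) /= => V0.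
apply/eqP; rewrite -subr_eq0 opprB addrCA -sumrB -big_split /=.
rewrite /arc /in_right_arc; case: (ltnP t h) => lth.
  rewrite big1 // => p _; rewrite ltnS.
  by case: (ltnP t p) => ?; case: (ltnP p h) => ? /=; lia.
(* Now the arc runs through the base point: each summand is a full letter step, so the sum is the
   total height, which is zero. *)
have {}lth : (h < t)%N by rewrite ltn_neqAle eq_sym th.
rewrite -[X in _ == X]V0; apply/eqP; apply: eq_bigr => p _.
rewrite (ltn_ord p) ltnS; case: (ltnP t p) => ?; case: (ltnP p h) => ? /=; lia.
Qed.

End Wf.

(** Since the total height is zero, reading [w1 ++ w2] from height [height w2] gives both blocks the
    heights they have in [w2 ++ w1], and a shifted start leaves indices unchanged. *)
Lemma hindex_rot w1 w2 l : wf_gword (w1 ++ w2) ->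
  hindex 0 (w2 ++ w1) l = hindex 0 (w1 ++ w2) l.
Proof.
move=> wfw; have h0 := height_wf wfw; have := hindex_wf_shift wfw (height w2) l.
rewrite height_cat in h0; rewrite !hindex_cat !add0r (addrC (height w2)) h0 => <-.
exact: addrC.
Qed.

End ChordIndex.

(** * Right division and the reading of colours along a word *)

Section Colorings.
Local Open Scope ring_scope.
Variables (Q : finType) (op : int -> Q -> Q -> Q) (A : zmodType) (phi : Q -> Q -> A).
Hypothesis opQ : indexed_quandle op.
Hypothesis phiQ : iq_2cocycle op phi.

(** Right division: by [iq_rdiv] the [pick] always succeeds, and the default [b] only makes the
    function total. *)
Definition iop (i : int) (c b : Q) : Q := odflt b [pick a | op i a b == c].

Lemma iopK i c b : op i (iop i c b) b = c.
Proof.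
rewrite /iop; case: pickP => [a /eqP//|none].
by have [a [/eqP]] := iq_rdiv opQ i b c; rewrite none.
Qed.

Lemma opI i a a' b : op i a b = op i a' b -> a = a'.
Proof.
move=> e; have [a1 [_ u]] := iq_rdiv opQ i b (op i a b).
by rewrite -(u a erefl) -(u a' (esym e)).
Qed.

Lemma opK i a b : iop i (op i a b) b = a.
Proof. by apply: (@opI i _ _ b); rewrite iopK. Qed.

(* The colour after (resp. the weight of) an undercrossing of sign [s] and
   index [i] met with colour [c] under an arc of colour [b]. *)
Definition pass (s : bool) (i : int) (c b : Q) : Q :=
  if s then op i c b else iop i c b.
Definition pass_weight (s : bool) (i : int) (c b : Q) : A :=
  if s then phi c b else - phi (iop i c b) b.

Lemma passK s i c b : pass s i (pass (~~ s) i c b) b = c.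
Proof. by case: s; rewrite /= ?iopK ?opK. Qed.

Lemma passNK s i c b : pass (~~ s) i (pass s i c b) b = c.
Proof. by case: s; rewrite /= ?iopK ?opK. Qed.

(* Reading a word from a start colour: [B] prescribes the colour of the
   over-arc of each label and [I] its index. *)
Section Read.
Variables (B : nat -> Q) (I : nat -> int).

Definition next (c : Q) (y : letter) : Q :=
  if ovr y then c else pass (sgn y) (I (lab y)) c (B (lab y)).

Definition final (w : gword) (c : Q) : Q := foldl next c w.

Fixpoint valid (w : gword) (c : Q) : bool :=
  if w is y :: w' then (ovr y ==> (B (lab y) == c)) && valid w' (next c y) else true.

Fixpoint total (w : gword) (c : Q) : A :=
  if w is y :: w' then
    (if ovr y then 0 else pass_weight (sgn y) (I (lab y)) c (B (lab y)))
      + total w' (next c y)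
  else 0.

Lemma final_cat w1 w2 c : final (w1 ++ w2) c = final w2 (final w1 c).
Proof. exact: foldl_cat. Qed.

Lemma valid_cat w1 w2 c :
  valid (w1 ++ w2) c = valid w1 c && valid w2 (final w1 c).
Proof. by elim: w1 c => //= y w1 IH c; rewrite IH andbA. Qed.

Lemma total_cat w1 w2 c :
  total (w1 ++ w2) c = total w1 c + total w2 (final w1 c).
Proof. by elim: w1 c => [|y w1 IH] c /=; rewrite ?add0r // IH addrA. Qed.

Lemma final_take p w c : (p < size w)%N ->
  final (take p.+1 w) c = next (final (take p w) c) (nth x0 w p).
Proof. by move=> pw; rewrite (take_nth x0 pw) /final foldl_rcons. Qed.

Lemma validP w c : reflect (forall p, (p < size w)%N -> ovr (nth x0 w p) ->
    B (lab (nth x0 w p)) = final (take p w) c) (valid w c).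
Proof.
apply: (iffP idP) => [|H].
  elim: w c => //= y w IH c /andP[/implyP oy vw] [|p] //= pw op'.
    by apply/eqP; apply: oy.
  exact: IH vw p pw op'.
elim: w c H => //= y w IH c H; rewrite IH ?andbT => [|p pw]; last exact: (H p.+1).
by apply/implyP => oy; rewrite (H 0%N).
Qed.

Lemma totalE w c : total w c = \sum_(p < size w)
  let y := nth x0 w p in if ovr y then 0 else
    pass_weight (sgn y) (I (lab y)) (final (take p w) c) (B (lab y)).
Proof.
elim: w c => [|y w IH] c /=; first by rewrite big_ord0.
by rewrite big_ord_recl /= IH.
Qed.

End Read.

Lemma read_ext B B' I I' w c :
  {in labels w, B =1 B'} -> {in labels w, I =1 I'} ->
  [/\ final B I w c = final B' I' w c, valid B I w c = valid B' I' w c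
      & total B I w c = total B' I' w c].
Proof.
elim: w c => //= y w IH c eB eI.
have eBy : B (lab y) = B' (lab y) by apply: eB; rewrite inE eqxx.
have eIy : I (lab y) = I' (lab y) by apply: eI; rewrite inE eqxx.
have ey : next B I c y = next B' I' c y by rewrite /next eBy eIy.
have [l lw|l lw|] := IH (next B I c y).
- by apply: eB; rewrite inE lw orbT.
- by apply: eI; rewrite inE lw orbT.
by rewrite ey eBy eIy => -> -> ->.
Qed.

(** * Colorings as solutions of the reading equations *)

Definition solution (w : gword) (g : A) (s : Q * (nat -> Q)) : bool :=
  let I := hindex 0 w in
  [&& final s.2 I w s.1 == s.1, valid s.2 I w s.1 & total s.2 I w s.1 == g].

(** Over-arc colours are functions on all of [nat], so solutions are compared only on the labels
    that occur. *)
Definition agree (w : gword) (s s' : Q * (nat -> Q)) : Prop :=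
  s.1 = s'.1 /\ {in labels w, s.2 =1 s'.2}.

(** The last gap cyclically precedes position 0, so reading starts from its colour; for the empty
    word it is the whole circle. *)
Definition encode (w : gword) (col : 'I_(ngaps w) -> Q) : Q * (nat -> Q) :=
  (gapc w col (size w).-1, fun l => gapc w col (tailpos w l)).

Definition decode (w : gword) (s : Q * (nat -> Q)) : {ffun 'I_(ngaps w) -> Q} :=
  [ffun p : 'I_(ngaps w) => final s.2 (hindex 0 w) (take p.+1 w) s.1].

Section Encoding.
Variable w : gword.
Hypothesis wfw : wf_gword w.

Lemma ltn_ngaps p : (p < size w)%N -> (p < ngaps w)%N.
Proof. by rewrite /ngaps; case: (size w). Qed.

Lemma crossing_okE (col : 'I_(ngaps w) -> Q) p : (p < size w)%N ->
  crossing_ok op w col p = (gapc w col p ==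
    next (encode col).2 (hindex 0 w) (gapc w col (prevpos w p)) (nth x0 w p)).
Proof.
move=> pw; rewrite /crossing_ok /next; case: (ovr _) => //=.
rewrite (chord_indexE wfw (lab_nth pw)); case: (sgn _) => //=.
by apply/eqP/eqP => ->; rewrite ?opK ?iopK.
Qed.

Lemma is_coloringP (col : 'I_(ngaps w) -> Q) :
  reflect (forall p, (p < size w)%N -> crossing_ok op w col p) (is_coloring op w col).
Proof.
apply: (iffP forallP) => [H p pw|H p]; last by apply/implyP; exact: H.
by have /implyP := H (Ordinal (ltn_ngaps pw)); apply.
Qed.

Lemma final_prev (col : 'I_(ngaps w) -> Q) (s : Q * (nat -> Q)) :
  gapc w col (size w).-1 = s.1 ->
  (forall p, (p < size w)%N ->
    gapc w col p = final s.2 (hindex 0 w) (take p.+1 w) s.1) ->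
  forall p, (p < size w)%N ->
    gapc w col (prevpos w p) = final s.2 (hindex 0 w) (take p w) s.1.
Proof.
move=> e0 e [|p] pw; first by rewrite take0.
by rewrite /prevpos /= e // ltnW.
Qed.

Lemma weightE (col : 'I_(ngaps w) -> Q) (s : Q * (nat -> Q)) :
  gapc w col (size w).-1 = s.1 ->
  (forall p, (p < size w)%N ->
    gapc w col p = final s.2 (hindex 0 w) (take p.+1 w) s.1) ->
  {in labels w, forall l, gapc w col (tailpos w l) = s.2 l} ->
  weight op phi w col = total s.2 (hindex 0 w) w s.1.
Proof.
move=> e0 e eB; rewrite totalE; apply: eq_bigr => p _ /=.
have pw := ltn_ord p; have lw := lab_nth pw.
case: ifP => op' //; rewrite (final_prev e0 e pw) (e _ pw) (eB _ lw).
rewrite final_take // /next op' (lock hindex) /=.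
by case: (sgn _).
Qed.

Lemma final_encode (col : 'I_(ngaps w) -> Q) p : is_coloring op w col ->
  (p < size w)%N ->
  gapc w col p = final (encode col).2 (hindex 0 w) (take p.+1 w) (encode col).1.
Proof.
move=> /is_coloringP ok; elim: p => [|p IH] pw; rewrite final_take //.
  by have := ok _ pw; rewrite crossing_okE // take0 => /eqP.
by rewrite -IH ?(ltnW pw) //; have := ok _ pw; rewrite crossing_okE // => /eqP.
Qed.

Lemma encode_solution (col : 'I_(ngaps w) -> Q) : is_coloring op w col ->
  solution w (weight op phi w col) (encode col).
Proof.
move=> ok; have e p := @final_encode col p ok; apply/and3P; split.
- case: (posnP (size w)) => [/size0nil w0|wp]; last first.
  have := e (size w).-1; rewrite prednK // take_size => <- //.
  by move: (encode col) => s; rewrite w0.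
- apply/validP => p pw op'; rewrite /= tailposK // e // final_take // /next op'.
  by [].
- by rewrite -(weightE (col := col)).
Qed.

Lemma decodeE s p : (p < size w)%N ->
  gapc w (decode w s) p = final s.2 (hindex 0 w) (take p.+1 w) s.1.
Proof. by move=> pw; rewrite /gapc ffunE inordK // ltn_ngaps. Qed.

Lemma decode_last g s : solution w g s -> gapc w (decode w s) (size w).-1 = s.1.
Proof.
move=> /and3P[/eqP e _ _]; rewrite /gapc ffunE inordK // -[RHS]e take_oversize //.
exact: leqSpred.
Qed.

Lemma decode_tail g s : solution w g s ->
  {in labels w, forall l, gapc w (decode w s) (tailpos w l) = s.2 l}.
Proof.
move=> /and3P[_ /validP v _] l lw; have [t1 t2 t3] := tailposP wfw lw.
by rewrite decodeE // final_take // /next t3 -v // t2.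
Qed.

Lemma decodeK g s : solution w g s -> agree w (encode (decode w s)) s.
Proof.
by move=> sol; split; [exact: decode_last sol | exact: decode_tail sol].
Qed.

Lemma decode_coloring g s : solution w g s ->
  is_coloring op w (decode w s) && (weight op phi w (decode w s) == g).
Proof.
move=> sol; have e p := @decodeE s p; have e0 := decode_last sol.
have eB := decode_tail sol; apply/andP; split; last first.
  by rewrite (weightE e0 e eB); case/and3P: sol.
apply/is_coloringP => p pw; rewrite crossing_okE // (final_prev e0 e) // e //.
by rewrite final_take // /next [(encode _).2 _](eB _ (lab_nth pw)).
Qed.

Lemma decode_agree s s' : agree w s s' -> decode w s = decode w s'.
Proof.
case=> e eB; apply/ffunP => p; rewrite !ffunE e.
by have [] := @read_ext s.2 s'.2 (hindex 0 w) (hindex 0 w) (take p.+1 w) s'.1;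
   rewrite // => l /mapP[y /mem_take yw ->]; apply: eB; apply: map_f.
Qed.

Lemma encodeK (col : {ffun 'I_(ngaps w) -> Q}) :
  is_coloring op w col -> decode w (encode col) = col.
Proof.
move=> ok; apply/ffunP => p; have pg := ltn_ord p.
have := @decodeE (encode col) p; have := @final_encode col p ok.
rewrite /gapc inord_val; case: (ltnP p (size w)) => [pw -> // -> //|wp _ _].
(* A gap that follows no letter exists only for the empty word, where it is gap 0. *)
rewrite ffunE; have p0 : (p = 0 :> nat)%N by move: pg wp; rewrite /ngaps; lia.
have s0 : size w = 0%N by lia.
have w0 : w = [::] by apply: size0nil.
rewrite take_oversize ?w0 //; last by lia.
have -> B I c : final B I w c = c by rewrite w0.
rewrite /= /gapc; congr (col _); apply: val_inj; by rewrite /= inordK // s0 [RHS]p0.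
Qed.

End Encoding.

(** Encoding, applying [F] and decoding maps colorings of weight [g] to colorings of weight [g],
    injectively because [encode] and [decode] are inverse up to [agree]. *)
Lemma Phi_le w w' g (F : Q * (nat -> Q) -> Q * (nat -> Q)) :
  wf_gword w -> wf_gword w' ->
  (forall s, solution w g s -> solution w' g (F s)) ->
  (forall s s', solution w g s -> solution w g s' ->
     agree w' (F s) (F s') -> agree w s s') ->
  (Phi op phi w g <= Phi op phi w' g)%N.
Proof.
move=> wfw wfw' Fsol Finj.
pose f (col : {ffun 'I_(ngaps w) -> Q}) := decode w' (F (encode col)).
rewrite /Phi; set P := [pred col | _]; set P' := [pred col | _].
have sol col : col \in P -> solution w g (encode col).
  by case/andP=> ok /eqP <-; apply: encode_solution.
have fP col : col \in P -> f col \in P'.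
  by move=> /sol/Fsol/(decode_coloring wfw').
have finj : {in P &, injective f}.
  move=> c c' Pc Pc' e; have := Finj _ _ (sol _ Pc) (sol _ Pc').
  have [a1 a2] := decodeK wfw' (Fsol _ (sol _ Pc)).
  have [b1 b2] := decodeK wfw' (Fsol _ (sol _ Pc')).
  case/andP: Pc => okc _; case/andP: Pc' => okc' _.
  rewrite -[RHS](encodeK wfw okc') -[LHS](encodeK wfw okc) => H.
  apply: decode_agree; apply: H; split; first by rewrite -a1 -b1 -/(f c) e.
  by move=> l lw; rewrite -a2 // -b2 // -/(f c) e.
rewrite -(card_in_image finj); apply/subset_leq_card/subsetP => _ /imageP[c Pc ->].
exact: fP.
Qed.

(** * Change of base point and of labels *)

Lemma solution_eq w g s s' : agree w s s' -> solution w g s = solution w g s'.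
Proof.
rewrite /solution => -[<- eB].
by have [//|-> -> ->] := @read_ext _ _ (hindex 0 w) (hindex 0 w) w s.1 eB.
Qed.

Lemma solution_index w I g c B : hindex 0 w =1 I ->
  solution w g (c, B) = [&& final B I w c == c, valid B I w c & total B I w c == g].
Proof.
move=> eI; rewrite /solution /=.
by have [//|l _|-> -> ->] := @read_ext B B (hindex 0 w) I w c; first exact: eI.
Qed.

(** The base point moves past [w1], so the new base colour is the one read there and over-arc
    colours stay. The reverse inequality is the same statement with the blocks exchanged. *)
Lemma Phi_rot w1 w2 g : wf_gword (w1 ++ w2) -> wf_gword (w2 ++ w1) ->
  (Phi op phi (w1 ++ w2) g <= Phi op phi (w2 ++ w1) g)%N.
Proof.
move=> wf12 wf21; set I := hindex 0 (w1 ++ w2).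
have rI B w c : [/\ final B (hindex 0 (w2 ++ w1)) w c = final B I w c,
    valid B (hindex 0 (w2 ++ w1)) w c = valid B I w c
    & total B (hindex 0 (w2 ++ w1)) w c = total B I w c].
  by apply: read_ext => // l _; apply: hindex_rot.
apply: (@Phi_le _ _ _ (fun s => (final s.2 I w1 s.1, s.2))) => // [[c B]|[c B] [c' B']].
  rewrite /solution /= -/I; have [-> -> ->] := rI B (w2 ++ w1) (final B I w1 c).
  rewrite !final_cat !valid_cat !total_cat => /and3P[/eqP-> /andP[-> ->] /eqP<-].
  by rewrite eqxx addrC eqxx.
rewrite /solution /= -/I !final_cat => /and3P[/eqP e _ _] /and3P[/eqP e' _ _].
case=> /= e1 eB; have sub2 : {in labels w2, B =1 B'}.
  by move=> l lw; apply: eB; rewrite /labels map_cat mem_cat lw.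
split=> /=; last by move=> l; rewrite /labels map_cat mem_cat orbC -mem_cat -map_cat => /eB.
(* Reading [w2] from the new base colour returns the old one, which is thereby recovered. *)
by rewrite -e -e' -e1; have [] := @read_ext B B' I I w2 (final B I w1 c).
Qed.

Lemma read_map f B I w c :
  let w' := map (fun y => (f (lab y), ovr y, sgn y)) w in
  [/\ final B I w' c = final (B \o f) (I \o f) w c,
      valid B I w' c = valid (B \o f) (I \o f) w c
    & total B I w' c = total (B \o f) (I \o f) w c].
Proof.
elim: w c => //= y w IH c.
by have [-> -> ->] := IH (next B I c (f (lab y), ovr y, sgn y)).
Qed.

Lemma hindex_map f k w l : injective f ->
  hindex k (map (fun y => (f (lab y), ovr y, sgn y)) w) (f l) = hindex k w l.
Proof. by move=> fI; elim: w k => //= y w IH k; rewrite IH (inj_eq fI). Qed.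

Lemma solution_map f w g c B : injective f ->
  solution (map (fun y => (f (lab y), ovr y, sgn y)) w) g (c, B)
    = solution w g (c, B \o f).
Proof.
move=> fI; rewrite /solution /=; have [-> -> ->] := read_map f B
  (hindex 0 (map (fun y => (f (lab y), ovr y, sgn y)) w)) w c.
have [//|l _|-> -> -> //] := @read_ext (B \o f) (B \o f)
  (hindex 0 (map (fun y => (f (lab y), ovr y, sgn y)) w) \o f) (hindex 0 w) w c.
exact: hindex_map.
Qed.

Lemma Phi_relabel f w g : injective f ->
  let w' := map (fun y => (f (lab y), ovr y, sgn y)) w in
  wf_gword w -> wf_gword w' -> Phi op phi w g = Phi op phi w' g.
Proof.
move=> fI w' wfw wfw'.
have lw' : labels w' = map f (labels w) by rewrite /labels -!map_comp.
(* A left inverse of [f] on the labels of [w], found by position in the label list. *)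
pose f' l := nth 0%N (labels w) (index l (labels w')).
have f'K : {in labels w, cancel f f'}.
  by move=> l lw; rewrite /f' lw' index_map // nth_index.
apply/eqP; rewrite eqn_leq; apply/andP; split.
  apply: (@Phi_le _ _ _ (fun s => (s.1, s.2 \o f'))) => // [s sol|s s' _ _ [/= e eB]].
    rewrite solution_map // -(@solution_eq _ _ s) //.
    by split=> // l lw /=; rewrite f'K.
  split=> // l lw; have := eB (f l); rewrite /= f'K //; apply.
  by rewrite lw' map_f.
apply: (@Phi_le _ _ _ (fun s => (s.1, s.2 \o f))) => // [[c B]|s s' _ _ [/= e eB]].
  by rewrite solution_map.
by split=> // l; rewrite lw' => /mapP[l' lw ->]; apply: eB.
Qed.

(** * First and second Reidemeister moves *)

(** Both moves insert chords whose over-arc colour is forced to be the colour read after [w1]; a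
    solution of [w] then extends to [w'] in exactly one way up to [agree]. *)
Lemma Phi_insert (w w' w1 : gword) (new : seq nat) g :
  wf_gword w -> wf_gword w' ->
  {subset labels w1 <= labels w} -> {subset labels w <= labels w'} ->
  {in labels w', forall l, (l \in labels w) || (l \in new)} ->
  {in new, forall l, l \notin labels w} ->
  (forall s, solution w' g s = solution w g s &&
     all (fun l => s.2 l == final s.2 (hindex 0 w) w1 s.1) new) ->
  Phi op phi w g = Phi op phi w' g.
Proof.
move=> wfw wfw' s1 sw sw' dn sol.
have rd s s' : agree w s s' -> final s.2 (hindex 0 w) w1 s.1 = final s'.2 (hindex 0 w) w1 s'.1.
  case=> <- eB; have [l /s1 lw| //|//] := @read_ext s.2 s'.2 (hindex 0 w)
    (hindex 0 w) w1 s.1; exact: eB.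
apply/eqP; rewrite eqn_leq; apply/andP; split.
  pose F (s : Q * (nat -> Q)) :=
    (s.1, fun l => if l \in new then final s.2 (hindex 0 w) w1 s.1 else s.2 l).
  have agF s : agree w (F s) s.
    by split=> //= l lw; case: ifP => // /dn; rewrite lw.
  apply: (@Phi_le _ _ _ F) => // [s ss|s s' _ _ [e eB]].
    rewrite sol (solution_eq _ (agF s)) ss (rd _ _ (agF s)) /=.
    by apply/allP => l ln; rewrite ln.
  split=> // l lw; have [_ /(_ l lw) <-] := agF s; have [_ /(_ l lw) <-] := agF s'.
  by apply/eB/sw.
apply: (@Phi_le _ _ _ id) => // [s|s s']; first by rewrite sol => /andP[].
rewrite !sol => /andP[_ /allP n] /andP[_ /allP n'] [e eB]; split=> // l lw'.
case/orP: (sw' l lw') => [/eB//|ln].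
by rewrite (eqP (n l ln)) (eqP (n' l ln)); apply: rd.
Qed.

Lemma pass0 s q : pass s 0 q q = q.
Proof.
by case: s; rewrite /= ?(iq_idem opQ) // -{1}(iq_idem opQ q) opK.
Qed.

Lemma pass_weight0 s q : pass_weight s 0 q q = 0.
Proof.
have [p0 _] := phiQ; rewrite /pass_weight.
by case: s; rewrite ?p0 // -[iop _ _ _]/(pass false 0 q q) pass0 p0 oppr0.
Qed.

(** The kink has total height zero and its chord has index 0, so idempotence of the operation at 0
    and the vanishing of [phi] on the diagonal leave colour and weight unchanged. *)
Lemma Phi_R1 w1 w2 c o s g : c \notin labels (w1 ++ w2) ->
  let w' := w1 ++ [:: (c, o, s); (c, ~~ o, s)] ++ w2 in
  wf_gword (w1 ++ w2) -> wf_gword w' ->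
  Phi op phi (w1 ++ w2) g = Phi op phi w' g.
Proof.
move=> cw; set k := [:: _; _] => w' wfw wfw'.
have [cw1 cw2] : c \notin labels w1 /\ c \notin labels w2.
  by apply/norP; rewrite -mem_cat -map_cat.
have hk : height k = 0.
  by rewrite /k !height_cons height_nil /step /ovr /=; case: (o); case: (s).
have Ik l : hindex 0 w' l = hindex 0 (w1 ++ w2) l.
  rewrite !hindex_cat hk addr0; congr (_ + _); rewrite -[RHS]add0r; congr (_ + _).
  rewrite /k /= /lab /ovr /step /=; case: (c == l) => //=.
  by case: (o); case: (s) => /=; rewrite /sgn /=; lia.
have Ic : hindex 0 w' c = 0 by rewrite Ik hindex_notin.
apply: (@Phi_insert _ _ w1 [:: c]) => //.
- by move=> l; rewrite /labels map_cat mem_cat => ->.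
- move=> l; rewrite /labels !map_cat !mem_cat => /orP[] ->; by rewrite ?orbT.
- move=> l; rewrite /labels !map_cat !mem_cat /= !inE /lab /=.
  by do !case: (_ \in _) => //=; case: (_ == _).
- by move=> l; rewrite inE => /eqP->.
case=> d B; set I := hindex 0 (w1 ++ w2).
rewrite (solution_index _ _ _ Ik) /solution /= -/I andbT.
rewrite !final_cat !valid_cat !total_cat; set q := final B I w1 d.
have vk : valid B I k q = (B c == q).
  rewrite /k /= /next /ovr /lab /sgn /= /I -Ik Ic.
  case: (o) => /=; rewrite andbT //.
  (* When the head comes first, [B c] is the result of passing [q] under [B c] itself; undoing the
     pass and using idempotence gives [q]. *)
  apply/eqP/eqP => [e|->]; last by rewrite pass0.
  by rewrite -[RHS](passNK s 0 q (B c)) -e pass0.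
have fk : B c = q -> final B I k q = q /\ total B I k q = 0.
  rewrite /k /= /next /ovr /lab /sgn /= /I -Ik Ic => ->.
  by case: (o) => /=; rewrite pass0 pass_weight0 !addr0.
rewrite vk; case: (B c =P q) => [/fk[-> ->]|_]; last by rewrite !andbF.
by rewrite add0r !andbT.
Qed.

(** The two new chords have equal index, equal over-arc colour and opposite signs, so the second
    undercrossing undoes the first and their weights cancel. *)
Lemma Phi_R2 w1 w2 w3 c d s (rev : bool) g :
  c != d -> c \notin labels (w1 ++ w2 ++ w3) -> d \notin labels (w1 ++ w2 ++ w3) ->
  let w' := w1 ++ [:: (c, true, s); (d, true, ~~ s)] ++ w2 ++
         (if rev then [:: (d, false, ~~ s); (c, false, s)]
          else [:: (c, false, s); (d, false, ~~ s)]) ++ w3 in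
  wf_gword (w1 ++ w2 ++ w3) -> wf_gword w' ->
  Phi op phi (w1 ++ w2 ++ w3) g = Phi op phi w' g.
Proof.
move=> cd cw dw; set kt := [:: _; _]; set kh := if rev then _ else _ => w' wfw wfw'.
have dc : d != c by rewrite eq_sym.
have lkh : labels kh =i [:: c; d].
  by move=> l; rewrite /kh; case: (rev); rewrite /labels /= !inE // orbC.
have hkt : height kt = 0.
  by rewrite /kt !height_cons height_nil /step /=; case: (s).
have hkh : height kh = 0.
  by rewrite /kh; case: (rev); rewrite !height_cons height_nil /step /=; case: (s).
have out l : l \notin labels (w1 ++ w2 ++ w3) ->
    hindex 0 w' l = hindex (height w1) kt l + hindex (height w1 + height w2) kh l.
  rewrite /labels !map_cat !mem_cat !negb_or => /and3P[n1 n2 n3].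
  rewrite !hindex_cat hkt hkh !addr0 !add0r (hindex_notin _ n1) (hindex_notin _ n2).
  by rewrite (hindex_notin _ n3) !add0r addr0.
(* From [c] to [d] the height after the tail and the height before the head both change by [sign s],
   in either order of the heads. *)
have Icd : hindex 0 w' c = hindex 0 w' d.
  rewrite !out // /kt /kh; case: (rev); rewrite /= /lab /= !eqxx (negPf cd) (negPf dc).
    by rewrite /step /ovr /sgn /=; case: (s) => /=; lia.
  by rewrite /step /ovr /sgn /=; case: (s) => /=; lia.
(* One index function for both words: [c] and [d] do not occur in the shorter word, so they may take
   their values from the longer one. *)
set I := fun l => if l \in [:: c; d] then hindex 0 w' c else hindex 0 (w1 ++ w2 ++ w3) l.
have Iw' : hindex 0 w' =1 I.
  move=> l; rewrite /I !inE; case: eqP => [->//|/eqP lc].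
  case: eqP => [->//|/eqP ld] /=; rewrite !hindex_cat hkt hkh !addr0.
  have -> : hindex (0 + height w1) kt l = 0.
    by apply: hindex_notin; rewrite !inE negb_or lc.
  rewrite add0r; congr (_ + (_ + _)).
  by rewrite hindex_notin ?add0r // lkh !inE negb_or lc.
have Iw : {in labels (w1 ++ w2 ++ w3), hindex 0 (w1 ++ w2 ++ w3) =1 I}.
  by move=> l lw; rewrite /I !inE; do 2?case: eqP => [e|_]; rewrite // -e lw in cw dw *.
apply: (@Phi_insert _ _ w1 [:: c; d]) => //.
- by move=> l; rewrite /labels map_cat mem_cat => ->.
- move=> l; rewrite /labels !map_cat !mem_cat.
  by case/or3P => ->; rewrite ?orbT.
- move=> l; rewrite /labels !map_cat !mem_cat [l \in map lab kh]lkh !inE /lab /=.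
  by do !case: (_ \in _) => //=; do !case: (_ == _).
- by move=> l; rewrite !inE => /orP[] /eqP->.
case=> e B; rewrite (solution_index _ _ _ Iw') /solution /= andbT.
have rI w q : {subset labels w <= labels (w1 ++ w2 ++ w3)} ->
  [/\ final B (hindex 0 (w1 ++ w2 ++ w3)) w q = final B I w q,
      valid B (hindex 0 (w1 ++ w2 ++ w3)) w q = valid B I w q
    & total B (hindex 0 (w1 ++ w2 ++ w3)) w q = total B I w q].
  by move=> sw; apply: read_ext => // l /sw; apply: Iw.
have [//|-> -> ->] := rI (w1 ++ w2 ++ w3) e.
have [l lw|-> _ _] := rI w1 e; first by rewrite /labels map_cat mem_cat lw.
rewrite !final_cat !valid_cat !total_cat; set q := final B I w1 e.
have -> : final B I kt q = q by [].
have -> : total B I kt q = 0 by rewrite /= !addr0.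
have -> : valid B I kt q = (B c == q) && (B d == q) by rewrite /= andbT.
case: (B c =P q) => [Bc|_] /=; last by rewrite !andbF.
case: (B d =P q) => [Bd|_] /=; last by rewrite !andbF.
have Ic : I c = I d by rewrite /I !inE !eqxx orbT.
move: (final B I w2 q) (valid B I w2 q) (total B I w2 q) => r v2 t2.
have -> : final B I kh r = r.
  by rewrite /kh; case: (rev); rewrite /= /next /= /lab /ovr /sgn /= Ic Bc Bd ?passK ?passNK.
have -> : total B I kh r = 0.
  rewrite /kh; case: (rev); rewrite /= /next /= /lab /ovr /sgn /= Ic Bc Bd addr0;
  by rewrite /pass_weight; case: (s) => /=; rewrite ?iopK ?opK ?subrr ?addNr.
have -> : valid B I kh r by rewrite /kh; case: (rev).
by rewrite !add0r !andbT.
Qed.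

(** * Third Reidemeister move *)

(** The initial heights telescope as [c - a = (b - a) + (c - b)]; what remains is a finite check
    that the order and sign conditions make the neighbouring steps cancel. *)
Lemma hindex_r3 a b c x y z sx sy sz oT :
  let seg oT oM oB l :=
    hindex a (r3seg oT (x, true, sx) (y, true, sy)) l
    + hindex b (r3seg oM (x, false, sx) (z, true, sz)) l
    + hindex c (r3seg oB (y, false, sy) (z, false, sz)) l in
  let oM := oT (+) sy (+) sz in let oB := oT (+) sx (+) sz in
  (forall l, seg oT oM oB l = seg (~~ oT) (~~ oM) (~~ oB) l) /\
  (uniq [:: x; y; z] -> seg oT oM oB y = seg oT oM oB x + seg oT oM oB z).
Proof.
move=> seg oM oB; rewrite {}/oM {}/oB {}/seg; split=> [l|].
  case: oT; case: sx; case: sy; case: sz; rewrite /= /lab /step /ovr /sgn /=;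
  case: (x == l); case: (y == l); case: (z == l); lia.
rewrite /= !inE negb_or => /and3P[/andP[xy xz] yz _].
have [yx zx zy] : [/\ y != x, z != x & z != y] by split; rewrite eq_sym.
case: oT; case: sx; case: sy; case: sz; rewrite /= /lab /step /ovr /sgn /=;
  rewrite !eqxx (negPf xy) (negPf xz) (negPf yz) (negPf yx) (negPf zx) (negPf zy); lia.
Qed.

Lemma height_r3seg o u v : height (r3seg o u v) = step u + step v.
Proof.
by case: o; rewrite /r3seg !height_cons height_nil addr0 // addrC.
Qed.

Lemma labels_r3seg o u v : labels (r3seg o u v) =i [:: lab u; lab v].
Proof. by move=> l; case: o; rewrite /r3seg /= !inE // orbC. Qed.

(* The square of the bottom strand under the top and middle strands: passing
   below the middle arc to the left of the top arc and below its continuation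
   to the right lead to the same colour, with equal weights by the cocycle
   identity. *)
Lemma slide_pos sz ix iy iz b m t : iy = ix + iz ->
  pass sz iz (op iy b t) (op ix m t) = op iy (pass sz iz b m) t /\
  phi b t + pass_weight sz iz (op iy b t) (op ix m t)
    = pass_weight sz iz b m + phi (pass sz iz b m) t.
Proof.
move=> e; have ez : iz = iy - ix by lia.
have ex : ix = iy - iz by lia.
have dist a : op iy (op iz a m) t = op iz (op iy a t) (op ix m t).
  by rewrite ex; apply: iq_dist.
have coc a : phi a t + phi (op iy a t) (op ix m t) = phi a m + phi (op iz a m) t.
  have [_ /(_ a m t iy ix)] := phiQ; rewrite -ez => h.
  move/eqP: h; rewrite subr_eq0 -addrA addrC subr_eq => /eqP h.
  by rewrite addrC -h addrC.
case: sz => /=; first by rewrite dist coc.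
(* For negative [z] this is the positive square starting at [a], with the passages under the middle
   strand reversed. *)
have [a ->] : exists a, b = op iz a m by exists (iop iz b m); rewrite iopK.
rewrite dist /pass_weight !opK; split=> //.
by apply/eqP; rewrite subr_eq -addrA coc addKr.
Qed.

(** The sign [sy] tells from which side of the top arc the bottom strand arrives, hence which middle
    colour it meets in each order. A negative [sy] is the positive square with the passages under
    the top arc reversed. *)
Lemma slide sy sz ix iy iz b m t : iy = ix + iz ->
  let bottom (o : bool) c :=
    if o then (pass sz iz (pass sy iy b t) c,
               pass_weight sy iy b t + pass_weight sz iz (pass sy iy b t) c)
    else (pass sy iy (pass sz iz b c) t,
          pass_weight sz iz b c + pass_weight sy iy (pass sz iz b c) t) in
  bottom sy (op ix m t) = bottom (~~ sy) m.
Proof.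
move=> e; case: sy => /=; first by have [-> ->] := slide_pos sz b m t e.
have [a ->] : exists a, b = op iy a t by exists (iop iy b t); rewrite iopK.
have [h1 h2] := slide_pos sz a m t e.
rewrite opK h1 opK; congr (_, _).
by apply/eqP; rewrite subr_eq -addrA -h2 addKr.
Qed.

Lemma read_middle B I x z sx sz oM m :
  let M := r3seg oM (x, false, sx) (z, true, sz) in
  [/\ final B I M m = pass sx (I x) m (B x),
      total B I M m = pass_weight sx (I x) m (B x)
    & valid B I M m = (B z == if oM then pass sx (I x) m (B x) else m)].
Proof.
by case: oM; rewrite /= /next /= /lab /ovr /sgn /= ?andbT ?addr0 ?add0r.
Qed.

Lemma read_top B I x y sx sy oT q :
  let T := r3seg oT (x, true, sx) (y, true, sy) in
  [/\ final B I T q = q, total B I T q = 0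
    & valid B I T q = (B x == q) && (B y == q)].
Proof.
by case: oT; rewrite /= /next /= /lab /ovr /sgn /= ?andbT ?addr0 // andbC.
Qed.

(** Here [u] is the middle colour to the right of the top arc and [op ix u (B y)] the one to its
    left; the move carries the crossing [z] from one side to the other. *)
Lemma read_bottom B B' I y z sy sz ix u oB b :
  B' y = B y -> I y = ix + I z ->
  B z = (if oB == sy then op ix u (B y) else u) ->
  B' z = (if oB == sy then u else op ix u (B y)) ->
  let word o := r3seg o (y, false, sy) (z, false, sz) in
  final B' I (word (~~ oB)) b = final B I (word oB) b /\
  total B' I (word (~~ oB)) b = total B I (word oB) b.
Proof.
move=> By e; have := slide sy sz b u (B y) e.
case: oB; case: (sy) => /= -[e1 e2] Bz B'z;
rewrite /next /= /lab /ovr /sgn /= By Bz B'z ?addr0;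
by split; first [exact: e1 | exact: esym e1 | exact: e2 | exact: esym e2].
Qed.

Lemma labels_cat (w w' : gword) : labels (w ++ w') = labels w ++ labels w'.
Proof. exact: map_cat. Qed.

(** The six letters of the triangle use up both occurrences that well-formedness grants to each of
    its labels. *)
Lemma r3_fresh w1 w2 w3 w4 x y z sx sy sz oT oM oB alt :
  uniq [:: x; y; z] -> wf_gword (r3word w1 w2 w3 w4 x y z sx sy sz oT oM oB alt) ->
  {in [:: x; y; z], forall l,
    [/\ l \notin labels w1, l \notin labels w2, l \notin labels w3 & l \notin labels w4]}.
Proof.
rewrite /= !inE negb_or => /and3P[/andP[xy xz] yz _].
have [yx zx zy] : [/\ y != x, z != x & z != y] by split; rewrite eq_sym.
set w := r3word _ _ _ _ _ _ _ _ _ _ _ _ _ _ => wfw l lxyz.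
have [v vw lv] : exists2 v, v \in w & lab v = l.
  suff : l \in labels w by case/mapP=> v vw ->; exists v.
  rewrite /w /r3word; case: (alt); rewrite !labels_cat !mem_cat;
  rewrite !labels_r3seg; move: lxyz; rewrite !inE /lab /=;
  by case/or3P => ->; rewrite /= ?orbT.
have [c2 _ _] := wfw v vw; move: c2; rewrite lv => c2.
have cn u : count (fun y => lab y == l) u = 0%N -> l \notin labels u.
  move=> c0; apply/negP => /mapP[y' yu ly].
  have : has (fun y => lab y == l) u by apply/hasP; exists y'; rewrite // ly.
  by rewrite has_count c0.
have cs o (u u' : letter) : count (fun y => lab y == l) (r3seg o u u')
    = ((lab u == l) + (lab u' == l))%N.
  by case: o; rewrite /= addn0 // addnC.
suff : [/\ count (fun y => lab y == l) w1 = 0, count (fun y => lab y == l) w2 = 0,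
    count (fun y => lab y == l) w3 = 0 & count (fun y => lab y == l) w4 = 0]%N.
  by case=> *; split; apply: cn.
move: c2 lxyz; rewrite /w /r3word; case: (alt); rewrite !count_cat !cs !inE /lab /=;
move=> c2 /or3P[] /eqP e; move: c2; rewrite e !eqxx ?(negPf xy) ?(negPf xz)
  ?(negPf yz) ?(negPf yx) ?(negPf zx) ?(negPf zy); split; lia.
Qed.

(** The constants are chosen before the orders [oT], [oM], [oB]: a two-letter segment has the same
    height in either order, so the heights elsewhere do not depend on them. *)
Lemma hindex_r3word w1 w2 w3 w4 x y z sx sy sz alt :
  exists a b c (r : nat -> int),
  (forall oT oM oB l,
    hindex 0 (r3word w1 w2 w3 w4 x y z sx sy sz oT oM oB alt) l = r l
    + (hindex a (r3seg oT (x, true, sx) (y, true, sy)) l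
    + hindex b (r3seg oM (x, false, sx) (z, true, sz)) l
    + hindex c (r3seg oB (y, false, sy) (z, false, sz)) l)) /\
  (forall l, [/\ l \notin labels w1, l \notin labels w2, l \notin labels w3
     & l \notin labels w4] -> r l = 0).
Proof.
set sT := step (x, true, sx) + step (y, true, sy).
set sM := step (x, false, sx) + step (z, true, sz).
set sB := step (y, false, sy) + step (z, false, sz).
pose a := 0 + height w1; pose k1 := a + sT; pose d := k1 + height w2.
pose k2 := d + (if alt then sB else sM); pose e := k2 + height w3.
pose k3 := e + (if alt then sM else sB).
exists a, (if alt then e else d), (if alt then d else e), (fun l =>
  hindex 0 w1 l + hindex k1 w2 l + hindex k2 w3 l + hindex k3 w4 l); split.
- move=> oT oM oB l; rewrite /r3word /k3 /e /k2; case: (alt);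
  rewrite !hindex_cat !height_r3seg -/sT -/sM -/sB -/a -/k1 -/d /=; ring.
- by move=> l [n1 n2 n3 n4]; rewrite !hindex_notin.
Qed.

Lemma Phi_R3 w1 w2 w3 w4 x y z sx sy sz oT alt g : uniq [:: x; y; z] ->
  let oM := oT (+) sy (+) sz in let oB := oT (+) sx (+) sz in
  let w := r3word w1 w2 w3 w4 x y z sx sy sz oT oM oB alt in
  let w' := r3word w1 w2 w3 w4 x y z sx sy sz (~~ oT) (~~ oM) (~~ oB) alt in
  wf_gword w -> wf_gword w' -> (Phi op phi w g <= Phi op phi w' g)%N.
Proof.
move=> u oM oB w w' wfw wfw'; have fresh := r3_fresh u wfw.
set I := hindex 0 w.
have [I' Iy] : hindex 0 w' =1 I /\ I y = I x + I z.
  have [a [b [c [r [er r0]]]]] := hindex_r3word w1 w2 w3 w4 x y z sx sy sz alt.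
  have [h1 /(_ u) h2] := hindex_r3 a b c x y z sx sy sz oT.
  split=> [l|]; first by rewrite /I !er h1.
  have [rx ry rz] : [/\ r x = 0, r y = 0 & r z = 0].
    by split; apply/r0/fresh; rewrite !inE eqxx ?orbT.
  by rewrite /I !er rx ry rz !add0r.
have [xz yz] : x != z /\ y != z.
  by move: u; rewrite /= !inE negb_or => /and3P[/andP[_ ->] ->].
(* If [x] precedes [z] on the middle strand, [z] slides back before the undercrossing [x] and the
   pass is undone; otherwise [z] slides past it and the pass is applied. The exclusive or with [sx]
   covers both. *)
pose F (s : Q * (nat -> Q)) :=
  (s.1, fun l => if l == z then pass (oM (+) sx) (I x) (s.2 z) (s.2 x) else s.2 l).
have lw l : l \in labels w -> l \in labels w'.
  rewrite /w /w' /r3word; case: (alt); rewrite !labels_cat !mem_cat;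
  by rewrite !labels_r3seg.
have lx : x \in labels w.
  rewrite /w /r3word; case: (alt); rewrite !labels_cat !mem_cat !labels_r3seg;
  by rewrite inE eqxx ?orbT.
apply: (@Phi_le _ _ _ F) => // [[c B] sol|s s' _ _ [/= e eB]]; last first.
  have ex : s.2 x = s'.2 x by have := eB x (lw x lx); rewrite (negPf xz).
  split=> // l /lw/eB; case: eqP => // ->; rewrite ex => ez.
  by rewrite -[LHS](passNK (oM (+) sx) (I x) _ (s'.2 x)) ez passNK.
move: sol; set B' := (F (c, B)).2; rewrite [F _]surjective_pairing -/B' /=.
rewrite (solution_index _ _ _ I') (@solution_index w I) //.
have Bx : B' x = B x by rewrite /B' /= (negPf xz).
have By : B' y = B y by rewrite /B' /= (negPf yz).
have Bz : B' z = pass (oM (+) sx) (I x) (B z) (B x) by rewrite /B' /= eqxx.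
have rd v q : z \notin labels v -> [/\ final B' I v q = final B I v q,
    valid B' I v q = valid B I v q & total B' I v q = total B I v q].
  move=> zv; apply: read_ext => // l lv; rewrite /B' /=.
  by case: eqP => // e; rewrite -e lv in zv.
have [n1 n2 n3 n4] : [/\ z \notin labels w1, z \notin labels w2, z \notin labels w3
    & z \notin labels w4] by apply: fresh; rewrite !inE eqxx !orbT.
pose T o := r3seg o (x, true, sx) (y, true, sy).
pose M o := r3seg o (x, false, sx) (z, true, sz).
pose D o := r3seg o (y, false, sy) (z, false, sz).
have rT q : [/\ final B' I (T (~~ oT)) q = final B I (T oT) q,
    valid B' I (T (~~ oT)) q = valid B I (T oT) q
    & total B' I (T (~~ oT)) q = total B I (T oT) q].
  have [-> -> ->] := read_top B' I x y sx sy (~~ oT) q.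
  by have [-> -> ->] := read_top B I x y sx sy oT q; rewrite Bx By.
have rM m : valid B I (M oM) m -> [/\ final B' I (M (~~ oM)) m = final B I (M oM) m,
    valid B' I (M (~~ oM)) m
    & total B' I (M (~~ oM)) m = total B I (M oM) m].
  have [-> -> ->] := read_middle B' I x z sx sz (~~ oM) m.
  have [-> -> ->] := read_middle B I x z sx sz oM m; rewrite Bx Bz => /eqP->.
  by split=> //; case: (oM); rewrite /= ?addTb ?addFb ?passNK.
(* The start colours [m] of the middle and [b] of the bottom strand are independent, so this serves
   both cyclic orders. *)
have rD m b : B x = B y -> valid B I (M oM) m ->
    [/\ final B' I (D (~~ oB)) b = final B I (D oB) b,
    valid B' I (D (~~ oB)) b = valid B I (D oB) b
    & total B' I (D (~~ oB)) b = total B I (D oB) b].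
  have [_ _ ->] := read_middle B I x z sx sz oM m => exy /eqP ez.
  (* The middle colour to the right of the top arc is the incoming one if [x] is positive and the
     outgoing one if it is negative. *)
  have [] := @read_bottom B B' I y z sy sz (I x) (if sx then m else iop (I x) m (B x)) oB b.
  - by [].
  - by [].
  - rewrite ez -exy /oB /oM.
    by case: (oT); case: (sx); case: (sy); case: (sz); rewrite /= ?iopK ?opK.
  - rewrite Bz ez -exy /oB /oM.
    by case: (oT); case: (sx); case: (sy); case: (sz); rewrite /= ?iopK ?opK.
  by move=> -> ->; split=> //; rewrite /D; case: (oB).
have exy q : valid B I (T oT) q -> B x = B y.
  by have [_ _ ->] := read_top B I x y sx sy oT q => /andP[/eqP-> /eqP->].
rewrite /w /w' /r3word -!/(T _) -!/(M _) -!/(D _).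
case: (alt); rewrite !final_cat !valid_cat !total_cat.
  move=> /and3P[fc /andP[v1 /andP[vT /andP[v2 /andP[vD /andP[v3 /andP[vM v4]]]]]] tg].
  set q1 := final B I w1 c; set q2 := final B I (T oT) q1.
  set q3 := final B I w2 q2; set q4 := final B I (D oB) q3.
  set q5 := final B I w3 q4; set q6 := final B I (M oM) q5.
  have [-> -> ->] := rd w1 c n1; have [-> -> ->] := rT q1.
  have [-> -> ->] := rd w2 q2 n2; have [-> -> ->] := rD q5 q3 (exy _ vT) vM.
  have [-> -> ->] := rd w3 q4 n3; have [-> -> ->] := rM q5 vM.
  have [-> -> ->] := rd w4 q6 n4.
  by rewrite fc tg v1 vT v2 vD v3 v4.
move=> /and3P[fc /andP[v1 /andP[vT /andP[v2 /andP[vM /andP[v3 /andP[vD v4]]]]]] tg].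
set q1 := final B I w1 c; set q2 := final B I (T oT) q1.
set q3 := final B I w2 q2; set q4 := final B I (M oM) q3.
set q5 := final B I w3 q4; set q6 := final B I (D oB) q5.
have [-> -> ->] := rd w1 c n1; have [-> -> ->] := rT q1.
have [-> -> ->] := rd w2 q2 n2; have [-> -> ->] := rM q3 vM.
have [-> -> ->] := rd w3 q4 n3; have [-> -> ->] := rD q3 q5 (exy _ vT) vM.
have [-> -> ->] := rd w4 q6 n4.
by rewrite fc tg v1 vT v2 vD v3 v4.
Qed.

(** * Invariance under every move *)

Lemma Phi_move w w' g : gd_move w w' -> Phi op phi w g = Phi op phi w' g.
Proof.
case=> wfw wfw' st; case: st wfw wfw' => {w w'}.
- by move=> w1 w2 wf1 wf2; apply/eqP; rewrite eqn_leq !Phi_rot.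
- by move=> f w fI wf1 wf2; apply: Phi_relabel.
- by move=> *; apply: Phi_R1.
- by move=> *; apply: Phi_R2.
move=> w1 w2 w3 w4 x y z sx sy sz oT alt u wf1 wf2.
apply/eqP; rewrite eqn_leq Phi_R3 //=.
(* The inverse move is again of this form: negating [oT] negates the orders on the other two
   strands. *)
have := @Phi_R3 w1 w2 w3 w4 x y z sx sy sz (~~ oT) alt g u.
by rewrite /= !addNb !negbK; apply.
Qed.

End Colorings.

Theorem theorem5p9 (Q : finType) (op : int -> Q -> Q -> Q) (A : zmodType)
    (phi : Q -> Q -> A) :
  indexed_quandle op -> iq_2cocycle op phi ->
  forall K K' : gword, gd_equiv K K' ->
  forall g : A, Phi op phi K g = Phi op phi K' g.
Proof.
move=> opQ phiQ K K' + g; elim=> {K K'} [K K' mv|K|K K' _ ->|K1 K2 K3 _ -> _ ->] //.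
exact: Phi_move.
Qed.
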